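(* For each $n\ge 2$, let $(X_1,\ldots,X_n,Y_1,\ldots,Y_n)$ be a $2n$-dimensional vector of i.i.d. standard normally distributed random variables. For random variables $Z_i$ ($1\le i\le n$) and sequences $(a_n)$, $(b_n)$ of real numbers with $a_n>0$, consider the convergence in distribution to the standard Gumbel law, $$\lim_{n\to\infty}\mathbb{P}\Big(a_n^{-1}\big(\max_{1\le i\le n}Z_i-b_n\big)\le x\Big)=\exp\big(-e^{-x}\big)\quad\text{for all }x\in\mathbb{R}.\qquad(\ast)$$ Then all of the following hold. 1. If $Z_i=X_i$, then $(\ast)$ holds with $$a_n=\frac{1}{\sqrt{2\log(n)}},\qquad b_n=\sqrt{2\log(n)}+\delta_n,\qquad \delta_n=-\frac{\log(4\pi\log(n))}{2\sqrt{2\log(n)}}.$$ 2. If $Z_i=|X_i|$, then $(\ast)$ holds with $$a_n=\frac{1}{\sqrt{2\log(2n)}},\qquad b_n=\sqrt{2\log(2n)}+\delta_n,\qquad \delta_n=-\frac{\log(4\pi\log(2n))}{2\sqrt{2\log(2n)}}.$$ 3. If $Z_i=X_i+Y_i$, and as well if $Z_i=X_i-Y_i$, then $(\ast)$ holds with $$a_n=\frac{1}{\sqrt{\log(n)}},\qquad b_n=2\sqrt{\log(n)}+\delta_n,\qquad \delta_n=-\frac{\log(4\pi\log(n))}{2\sqrt{\log(n)}}.$$ 4. If $Z_i=|X_i|+|Y_i|$, then $(\ast)$ holds with $$a_n=\frac{1}{\sqrt{\log(4n)}},\qquad b_n=2\sqrt{\log(4n)}+\delta_n,\qquad \delta_n=-\frac{\log(4\pi\log(4n))}{2\sqrt{\log(4n)}}.$$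 5. If $Z_i=|X_i|-|Y_i|$, then $(\ast)$ holds with $$a_n=\frac{1}{\sqrt{2\log(n)}},\qquad b_n=\sqrt{2\log(n)}+\delta_n,\qquad \delta_n=-\frac{\log(\pi\log(n))}{\sqrt{2\log(n)}}.$$ 6. If $Z_i=\big||X_i|-|Y_i|\big|$, then $(\ast)$ holds with $$a_n=\frac{1}{\sqrt{2\log(2n)}},\qquad b_n=\sqrt{2\log(2n)}+\delta_n,\qquad \delta_n=-\frac{\log(\pi\log(2n))}{\sqrt{2\log(2n)}}.$$
   Context: $\log$ denotes the natural logarithm. The standard Gumbel distribution $\Lambda$ has cumulative distribution function $\Lambda(x)=\exp(-e^{-x})$, $x\in\mathbb{R}$. *)

(* Defs.v *)
From HB Require Import structures.
From mathcomp Require Export all_boot all_order all_algebra.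
From mathcomp Require Export all_classical all_reals all_analysis.

Set Implicit Arguments.
Unset Strict Implicit.
Unset Printing Implicit Defensive.

Export Order.TTheory GRing.Theory Num.Theory.
Export numFieldNormedType.Exports.

Local Open Scope classical_set_scope.
Local Open Scope ring_scope.

Definition independent_RVs (R : realType) (d : measure_display)
    (T : measurableType d) (P : probability T R) (I : finType)
    (W : I -> {RV P >-> R}) : Prop :=
  forall (J : {set I}) (A : I -> set R),
    (forall i, measurable (A i)) ->
    P (\bigcap_(i in [set i | i \in J]) (W i @^-1` A i)) =
    (\prod_(i in J) P (W i @^-1` A i))%E.

Definition standard_normal (R : realType) (d : measure_display)
    (T : measurableType d) (P : probability T R) (W : {RV P >-> R}) : Prop :=
  forall A : set R, measurable A -> distribution P W A = normal_prob 0 1 A.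

Definition joint (A : Type) (n : nat) (x y : 'I_n -> A) (k : 'I_n + 'I_n) : A :=
  match k with inl i => x i | inr i => y i end.

Definition iid_standard_normal (R : realType) (d : measure_display)
    (T : measurableType d) (P : probability T R) (I : finType)
    (W : I -> {RV P >-> R}) : Prop :=
  independent_RVs W /\ forall i, standard_normal (W i).

(* Computed in \bar R, where -oo is neutral for the maximum; the value is the
   true maximum as soon as n > 0 (see maxI_le and maxI_attained), and 0 for
   n = 0. *)
Definition maxI (R : realType) (n : nat) (z : 'I_n -> R) : R :=
  fine (\big[maxe/-oo%E]_(i < n) (z i)%:E).

Lemma maxIE (R : realType) (n : nat) (z : 'I_n -> R) : (0 < n)%N ->
  (maxI z)%:E = \big[maxe/-oo%E]_(i < n) (z i)%:E.
Proof.
case: n z => // n z _; rewrite /maxI fineK // fin_numE; apply/andP; split.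
  by rewrite big_ord_recl /= -ltNye lt_max ltNyr.
by rewrite -ltey; elim/big_ind: _ => // [x y hx hy|i _];
  rewrite ?gt_max ?hx ?hy ?ltry.
Qed.

Lemma maxI_le (R : realType) (n : nat) (z : 'I_n -> R) (y : R) : (0 < n)%N ->
  (maxI z <= y) = [forall i, z i <= y].
Proof.
move=> n0; rewrite -lee_fin maxIE //; apply/idP/forallP => [h i|h].
  by rewrite -lee_fin; apply: le_trans h; exact: le_bigmax.
by apply/bigmax_leP; split=> [|i _]; rewrite ?leNye ?lee_fin.
Qed.

Lemma maxI_attained (R : realType) (n : nat) (z : 'I_n -> R) : (0 < n)%N ->
  exists i, maxI z = z i.
Proof.
move=> n0; apply: contrapT => /forallNP h.
have zle i : z i <= maxI z.
  by move: (maxI_le z (maxI z) n0); rewrite lexx => /esym/forallP.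
have : ((maxI z)%:E < (maxI z)%:E)%E.
  rewrite [X in (X < _)%E]maxIE //; apply/bigmax_ltP; split; first exact: ltNyr.
  by move=> i _; rewrite lte_fin lt_neqAle zle andbT; apply/eqP => /esym/h.
by rewrite ltxx.
Qed.

Definition gumbel_cdf (R : realType) (x : R) : R := expR (- expR (- x)).

(* The vectors for different n may live on different probability spaces. *)
Definition max_cvg_gumbel (R : realType) (d : nat -> measure_display)
    (T : forall n, measurableType (d n)) (P : forall n, probability (T n) R)
    (Z : forall n, 'I_n -> T n -> R) (a b : nat -> R) : Prop :=
  (forall n, (2 <= n)%N -> 0 < a n) /\
  forall x : R,
    P n [set w | (a n)^-1 * (maxI (fun i => Z n i w) - b n) <= x]
      @[n --> \oo] --> (gumbel_cdf x)%:E.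

(* Main.v *)
Require Import Defs.
From HB Require Import structures.
From mathcomp Require Import measurable_realfun ring lra.

(** Every claim is an instance of one scheme. If the pairs (X_i, Y_i) are
i.i.d. and Z_i = f (X_i, Y_i) has tail probability 1 - P (Z_i <= s t) = H t,
then P (max Z_i <= s t) = (1 - H t) ^ n, and this tends to exp (- exp (- x))
along any t = t_n with n * H (t_n) --> exp (- x) ([cvg_onem_exprn]). When
H t ~ C t ^- k exp (- t ^ 2 / 2), such a t_n is
t_n = u + (x - ln (K u ^ k)) / u with exp (u ^ 2 / 2) = c n and K C = c: the
cross term of t_n ^ 2 / 2 cancels the factor t ^- k and produces exp (- x),
and the square of the correction, divided by u ^ 2, vanishes
([cvg_tail_norming]). Written out for each Z_i, this t_n is a_n x + b_n up to
the scale s.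

It remains to find H. Let Q be the tail of the standard normal law; integrating
the derivative of pdf x / x gives Q t ~ pdf t / t ([cvg_normal_tail]).
The standard normal law of the plane is invariant under the rotation by 45
degrees, (x, y) |-> (u, v) = ((x + y) / sqrt 2, (y - x) / sqrt 2)
([std_normal2_rot45]), and the rotation turns every event that involves both x
and y into a combination of products:
- x + y <= sqrt 2 t is u <= t, and x - y <= sqrt 2 t is - t <= v;
- |x| + |y| = max (|x + y|, |x - y|), so that |x| + |y| <= sqrt 2 t is the
  square |u| <= t, |v| <= t, of probability (1 - 2 Q t) ^ 2;
- ||x| - |y|| = min (|x + y|, |x - y|), so that ||x| - |y|| > sqrt 2 t is
  |u| > t, |v| > t, of probability (2 Q t) ^ 2, and |x| - |y| > sqrt 2 t
  consists of two of the four quadrants of that set.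
Here t >= 0 where absolute values occur. In the six cases 1 - P (Z_i <= s t) is
thus Q t, 2 Q t, Q t, 4 Q t - 4 (Q t) ^ 2, 2 Q (t / sqrt 2) ^ 2 and
4 Q (t / sqrt 2) ^ 2, with s = sqrt 2 in the third and the fourth case and s = 1
otherwise. The last two have k = 2, which is why their correction differs.

The hypothesis gives independence of X_1, ..., X_n, Y_1, ..., Y_n on products of
sets only. The events listed above are not products in (X_i, Y_i), so independence of
the pairs is first extended to all measurable sets of the plane, one index at a
time ([prob_forall_pairs]). *)

Set Implicit Arguments.
Unset Strict Implicit.
Unset Printing Implicit Defensive.

Local Open Scope classical_set_scope.
Local Open Scope ring_scope.

(** * Limits *)

Section limits.
Context {R : realType}.
Implicit Types (x t l : R) (p u : R^nat).

Lemma cvgy_sqrt : Num.sqrt x @[x --> +oo] --> (+oo : set_system R).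
Proof.
apply/cvgryPge => A; near=> x.
have : A ^+ 2 <= x by near: x; apply: nbhs_pinfty_ge; rewrite num_real.
by move=> /ler_wsqrtr; rewrite sqrtr_sqr; apply: le_trans; exact: ler_norm.
Unshelve. all: by end_near. Qed.

Lemma cvgy_ln : ln x @[x --> +oo] --> (+oo : set_system R).
Proof.
apply/cvgryPge => A; near=> x.
have x_ge : expR A <= x by near: x; apply: nbhs_pinfty_ge; rewrite num_real.
by rewrite -[leLHS]expRK ler_ln ?posrE ?expR_gt0//.
Unshelve. all: by end_near. Qed.

Lemma cvgy_inv : x^-1 @[x --> +oo] --> (0 : R).
Proof.
apply/(@gtr0_cvgV0 _ _ _ _ id) => //.
by apply: nbhs_pinfty_gt; rewrite num_real.
Qed.

(** With s = sqrt x, the bound ln s <= s reads ln x / x <= 2 / sqrt x. *)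
Lemma cvgy_ln_div : ln x / x @[x --> +oo] --> (0 : R).
Proof.
have sqrt0 : 2 * (Num.sqrt x)^-1 @[x --> +oo] --> (0 : R).
  rewrite -[X in _ --> X](mulr0 2); apply: cvgMl_tmp.
  exact: (cvg_comp _ _ cvgy_sqrt cvgy_inv).
apply: (@squeeze_cvgr _ _ _ _ (fun=> 0) _ _ _ _ (cvg_cst _) sqrt0).
near=> x.
have x_gt1 : 1 < x by near: x; apply: nbhs_pinfty_gt; rewrite num_real.
have x0 : 0 < x by lra.
have s0 : 0 < Num.sqrt x by rewrite sqrtr_gt0.
rewrite divr_ge0 ?ln_ge0 ?(ltW x0) ?(ltW x_gt1)//=.
move: s0; set s := Num.sqrt x => s0.
have -> : x = s ^+ 2 by rewrite sqr_sqrtr// ltW.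
rewrite lnXn// -mulr_natl expr2 ler_pdivrMr ?mulr_gt0// mulrA mulfVK ?gt_eqF//.
have := @le_ln1Dx _ (s - 1); rewrite (subrKC 1) => ls; have := ls _; lra.
Unshelve. all: by end_near. Qed.

(** Squeeze between exp (- n p / (1 - p)) and exp (- n p); both bounds are
1 + y <= exp y, at y = p / (1 - p) and at y = - p. *)
Lemma cvg_onem_exprn p l : (\forall n \near \oo, 0 <= p n) ->
  n%:R * p n @[n --> \oo] --> l ->
  (1 - p n) ^+ n @[n --> \oo] --> expR (- l).
Proof.
move=> p_ge0 npl.
have p0 : p n @[n --> \oo] --> 0.
  have h : n%:R^-1 * (n%:R * p n) @[n --> \oo] --> 0 * l.
    by apply: cvgM => //; exact: (cvg_comp _ _ cvgr_idn cvgy_inv).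
  rewrite mul0r in h; apply: cvg_trans h; apply: near_eq_cvg.
  near=> n; rewrite mulKf// pnatr_eq0 -lt0n; near: n; exact: nbhs_infty_gt.
have lo : expR (- (n%:R * p n * (1 - p n)^-1)) @[n --> \oo] --> expR (- l).
  apply: cvg_comp; last exact: continuous_expR.
  apply: cvgN; rewrite -[X in _ --> X]mulr1; apply: cvgM => //.
  rewrite -[X in _ --> X]invr1; apply: cvgV => //.
  by rewrite -[X in _ --> X](subr0 1); apply: cvgB => //; exact: cvg_cst.
have hi : expR (- (n%:R * p n)) @[n --> \oo] --> expR (- l).
  by apply: cvg_comp; [exact: cvgN npl|exact: continuous_expR].
apply: squeeze_cvgr lo hi; near=> n.
have pn0 : 0 <= p n by near: n.
have pn1 : p n < 1 by near: n; apply: cvgr_lt p0 _ _.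
have q0 : 0 < 1 - p n by lra.
rewrite -mulrA -!(mulrN n%:R) !expRM_natl.
apply/andP; split; rewrite lerXn2r ?nnegrE ?expR_ge0 ?(ltW q0)//; last first.
  exact: expR_ge1Dx.
rewrite expRN -[leRHS]invrK lef_pV2 ?posrE ?expR_gt0 ?invr_gt0//.
apply: le_trans (expR_ge1Dx _).
rewrite le_eqVlt; apply/orP; left; apply/eqP.
by field; rewrite gt_eqF.
Unshelve. all: by end_near. Qed.

(** The correction to the leading term [u n] is of order ln u / u. *)
Lemma cvg_norming_shift (k : nat) (K x : R) u : 0 < K ->
  u n @[n --> \oo] --> +oo ->
  (x - ln (K * u n ^+ k)) / u n @[n --> \oo] --> 0.
Proof.
move=> K0 uoo.
have u_gt0 : \forall n \near \oo, 0 < u n by exact: cvgry_gt.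
have h : (x - ln K) * (u n)^-1 - k%:R * (ln (u n) / u n) @[n --> \oo] -->
    (x - ln K) * 0 - k%:R * 0.
  apply: cvgB; apply: cvgMl_tmp.
    exact: (cvg_comp _ _ uoo cvgy_inv).
  exact: (cvg_comp _ _ uoo cvgy_ln_div).
rewrite !mulr0 subr0 in h; apply: cvg_trans h; apply: near_eq_cvg; near=> n.
have un0 : 0 < u n by near: n.
by rewrite lnM ?posrE ?exprn_gt0// lnXn// -mulr_natl; ring.
Unshelve. all: by end_near. Qed.

Lemma cvg_norming (k : nat) (K x : R) u : 0 < K ->
  u n @[n --> \oo] --> +oo ->
  u n + (x - ln (K * u n ^+ k)) / u n @[n --> \oo] --> +oo.
Proof.
move=> K0 uoo; have v0 := cvg_norming_shift k x K0 uoo.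
apply/cvgryPge => A; near=> n.
have : -1 < (x - ln (K * u n ^+ k)) / u n.
  by near: n; apply: cvgr_gt v0 _ _; rewrite ltrN10.
have : A + 1 <= u n by near: n; exact: cvgry_ge.
lra.
Unshelve. all: by end_near. Qed.

(** With v the correction, (u + v) ^ 2 / 2 = u ^ 2 / 2 + u v + v ^ 2 / 2, where
exp (u ^ 2 / 2) = c n and exp (u v) = exp x / (K u ^ k). Hence n * H (u + v) is
exp (- x) K / c times a factor tending to C, up to (u / (u + v)) ^ k and
exp (- v ^ 2 / 2), which tend to 1. *)
Lemma cvg_tail_norming (H : R -> R) (k : nat) (K C c x : R) u :
  0 < K -> 0 < c -> K * C = c ->
  H t * t ^+ k * expR (t ^+ 2 / 2) @[t --> +oo] --> C ->
  u n @[n --> \oo] --> +oo ->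
  (\forall n \near \oo, expR (u n ^+ 2 / 2) = c * n%:R) ->
  n%:R * H (u n + (x - ln (K * u n ^+ k)) / u n) @[n --> \oo] --> expR (- x).
Proof.
move=> K0 c0 KC HC uoo ueq.
pose v n := (x - ln (K * u n ^+ k)) / u n.
have u_gt0 : \forall n \near \oo, 0 < u n by exact: cvgry_gt.
have uV0 : (u n)^-1 @[n --> \oo] --> 0 by exact: (cvg_comp _ _ uoo cvgy_inv).
have v0 : v n @[n --> \oo] --> 0 by exact: cvg_norming_shift.
have too : u n + v n @[n --> \oo] --> +oo by exact: cvg_norming.
have vu0 : v n / u n @[n --> \oo] --> 0.
  by rewrite -(mulr0 0); exact: cvgM.
have r1 : (1 + v n / u n)^-1 ^+ k @[n --> \oo] --> (1 : R).
  have h : (1 + v n / u n)^-1 @[n --> \oo] --> (1 + 0 : R)^-1.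
    apply: cvgV; first by rewrite addr0 oner_neq0.
    by apply: cvgD => //; exact: cvg_cst.
  have := cvg_comp _ _ h (@exprn_continuous R k _).
  by rewrite addr0 invr1 expr1n.
have e1 : expR (- (v n ^+ 2 / 2)) @[n --> \oo] --> (1 : R).
  have h : - (v n * v n / 2) @[n --> \oo] --> (- (0 * 0 / 2) : R).
    by apply: cvgN; apply: cvgMr_tmp; exact: cvgM.
  have := cvg_comp _ _ h (@continuous_expR R _).
  by rewrite !mul0r oppr0 expR0.
have -> : expR (- x) = C * (K / c * expR (- x)) * 1 * 1.
  by rewrite !mulr1 -KC; field; rewrite ?gt_eqF//= -(pmulr_rgt0 _ K0) KC.
pose t n := u n + v n.
have main : H (t n) * t n ^+ k * expR (t n ^+ 2 / 2) * (K / c * expR (- x)) *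
    (1 + v n / u n)^-1 ^+ k * expR (- (v n ^+ 2 / 2))
    @[n --> \oo] --> C * (K / c * expR (- x)) * 1 * 1.
  apply: cvgM => //; apply: cvgM => //; apply: cvgMr_tmp.
  exact: (cvg_comp _ _ too HC).
apply: cvg_trans main; apply: near_eq_cvg; near=> n.
have un0 : 0 < u n by near: n.
have tn0 : 0 < u n + v n by near: n; exact: cvgry_gt.
have en : expR (u n ^+ 2 / 2) = c * n%:R by near: n.
rewrite -/(v n) /= /t.
have -> : n%:R = expR (u n ^+ 2 / 2) / c by rewrite en mulrC mulKf ?gt_eqF.
have Ku0 : 0 < K * u n ^+ k by rewrite mulr_gt0 ?exprn_gt0.
have -> : (u n + v n) ^+ 2 / 2 =
    u n ^+ 2 / 2 + (x - ln (K * u n ^+ k)) + v n ^+ 2 / 2.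
  by rewrite /v; field; rewrite gt_eqF.
have -> : (1 + v n / u n)^-1 = u n / (u n + v n).
  by field; rewrite !gt_eqF.
rewrite !expRD !expRN lnK ?posrE// (expr_div_n (u n)).
by field; rewrite !gt_eqF ?expR_gt0 ?exprn_gt0.
Unshelve. all: by end_near. Qed.

End limits.

(** * The normal tail *)

Section mills.
Context {R : realType}.
Implicit Types (x t : R).
Local Notation mu := lebesgue_measure.

Lemma std_normal_pdfE x :
  normal_pdf 0 1 x = (Num.sqrt (2 * pi))^-1 * expR (- (x ^+ 2 / 2)).
Proof.
rewrite normal_pdfE ?oner_neq0// /normal_peak /normal_fun.
by rewrite subr0 expr1n mul1r mulNr mulr_natl.
Qed.

Definition normal_tail t : R := fine (normal_prob 0 1 `]t, +oo[%classic).

Lemma normal_tailE t :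
  (normal_tail t)%:E = (\int[mu]_(x in `[t, +oo[) (normal_pdf 0 1 x)%:E)%E.
Proof.
rewrite fineK; last exact: fin_num_measure.
rewrite /normal_prob integral_itv_obnd_cbnd//.
by apply/measurable_EFinP/measurable_funTS; exact: measurable_normal_pdf.
Qed.

(** The integrand is the derivative of - pdf x / x, since the pdf satisfies
pdf' x = - x pdf x. *)
Lemma integral_mills t : 0 < t ->
  (\int[mu]_(x in `[t, +oo[) (normal_pdf 0 1 x * (1 + (x ^+ 2)^-1))%:E =
   (normal_pdf 0 1 t / t)%:E)%E.
Proof.
move=> t0.
pose F x : R := - (normal_pdf 0 1 x / x).
have dF x : 0 < x -> is_derive x 1 F (normal_pdf 0 1 x * (1 + (x ^+ 2)^-1)).
  move=> x0.
  have x_neq0 : x != 0 by rewrite gt_eqF.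
  have d1 : is_derive x 1 (fun y : R => - (y ^+ 2 / 2)) (- x).
    have -> : (fun y : R => - (y ^+ 2 / 2)) = - 2^-1 \*: (@id R ^+ 2).
      by apply/funext => y; rewrite /= scaleNr /GRing.scale/= mulrC.
    by apply: is_derive_eq; rewrite /GRing.scale/=; field.
  have d2 := @is_derive1_comp R expR (fun y : R => - (y ^+ 2 / 2)) x _ _
    (is_derive_expR _) d1.
  have d3 := is_deriveV x_neq0 (is_derive_id x (1 : R)).
  have d4 := is_deriveZ (- (Num.sqrt (2 * pi))^-1) (is_deriveM d2 d3).
  have -> : F = - (Num.sqrt (2 * pi))^-1 \*:
      ((expR \o (fun y : R => - (y ^+ 2 / 2))) * (fun y : R => y^-1)).
    apply/funext => y.
    by rewrite /F std_normal_pdfE /= scaleNr /GRing.scale/= mulrA.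
  apply: is_derive_eq; rewrite std_normal_pdfE /GRing.scale/=.
  by field; rewrite x_neq0 gt_eqF// sqrtr_gt0 mulr_gt0// pi_gt0.
rewrite (@ge0_continuous_FTC2y _
  (fun x => normal_pdf 0 1 x * (1 + x ^- 2)) F _ 0).
- by rewrite /F EFinN oppeK add0e.
- move=> x tx; rewrite mulr_ge0 ?normal_pdf_ge0// addr_ge0// invr_ge0 sqr_ge0//.
- apply: continuous_in_subspaceT => x; rewrite inE/= in_itv/= andbT => tx.
  apply: cvgM; first exact: continuous_normal_pdf.
  apply: cvgD; first exact: cvg_cst.
  apply: cvgV; first by rewrite expf_eq0 gt_eqF// (lt_le_trans t0).
  exact: exprn_continuous.
- rewrite -oppr0; apply: cvgN.
  have h : (Num.sqrt (2 * pi))^-1 * x^-1 @[x --> +oo] --> (0 : R).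
    rewrite -[X in _ --> X](mulr0 (Num.sqrt (2 * pi))^-1).
    by apply: cvgMl_tmp; exact: cvgy_inv.
  apply: squeeze_cvgr (cvg_cst 0) h; near=> x.
  have x0 : 0 < x by near: x; apply: nbhs_pinfty_gt; rewrite num_real.
  rewrite divr_ge0 ?normal_pdf_ge0 ?(ltW x0)//= ler_wpM2r ?invr_ge0 ?(ltW x0)//.
  rewrite std_normal_pdfE ler_piMr ?invr_ge0 ?sqrtr_ge0// expR_le1.
  by rewrite oppr_le0 divr_ge0 ?sqr_ge0.
- by move=> x tx; have [] := dF x (lt_trans t0 tx).
- have [df _] := dF t t0.
  apply: cvg_at_right_filter; apply: differentiable_continuous.
  exact/derivable1_diffP.
- move=> x; rewrite in_itv/= andbT => tx.
  by have [_] := dF x (lt_trans t0 tx); rewrite derive1E.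
Unshelve. all: by end_near. Qed.

Let measurable_itv_normal_pdf t :
  measurable_fun `[t, +oo[ (normal_pdf 0 1 : R -> R).
Proof. by apply: measurable_funTS; exact: measurable_normal_pdf. Qed.

(** On [t, +oo[ the factor 1 + x ^- 2 of [integral_mills] lies between 1 and
1 + t ^- 2. *)
Lemma normal_tail_bounds t : 0 < t ->
  normal_tail t <= normal_pdf 0 1 t / t <= (1 + t ^- 2) * normal_tail t.
Proof.
move=> t0; rewrite -!lee_fin (EFinM _ (normal_tail t)).
rewrite normal_tailE -integral_mills//.
have mf : measurable_fun `[t, +oo[
    (fun x : R => normal_pdf 0 1 x * (1 + x ^- 2)).
  apply: measurable_funM => //; apply: subspace_continuous_measurable_fun => //.
  apply: continuous_in_subspaceT => x; rewrite inE/= in_itv/= andbT => tx.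
  apply: cvgD; first exact: cvg_cst.
  apply: cvgV; first by rewrite expf_eq0 gt_eqF// (lt_le_trans t0).
  exact: exprn_continuous.
have mpdf := @measurable_itv_normal_pdf t.
have ge0V x : 0 <= x ^- 2 :> R by rewrite invr_ge0 sqr_ge0.
apply/andP; split.
  apply: ge0_le_integral => //=.
  - by move=> x _; rewrite lee_fin normal_pdf_ge0.
  - exact/measurable_EFinP.
  - exact/measurable_EFinP.
  - by move=> x _; rewrite lee_fin ler_peMr ?normal_pdf_ge0// lerDl.
rewrite -ge0_integralZl//=; last 3 first.
- exact/measurable_EFinP.
- by move=> x _; rewrite lee_fin normal_pdf_ge0.
- by rewrite lee_fin addr_ge0.
apply: ge0_le_integral => //=.
- by move=> x _; rewrite lee_fin mulr_ge0 ?normal_pdf_ge0// addr_ge0.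
- exact/measurable_EFinP.
- by apply/measurable_EFinP; exact: measurable_funM.
- move=> x; rewrite in_itv/= andbT => tx; rewrite -EFinM lee_fin mulrC.
  rewrite ler_wpM2r ?normal_pdf_ge0// lerD2l lef_pV2 ?posrE ?exprn_gt0//.
    by rewrite lerXn2r ?nnegrE ?(ltW t0) ?(le_trans (ltW t0)).
  exact: lt_le_trans tx.
Qed.

(** Mills' ratio: Q t ~ pdf t / t. *)
Lemma cvg_normal_tail :
  normal_tail t * t * expR (t ^+ 2 / 2) @[t --> +oo] --> (Num.sqrt (2 * pi))^-1.
Proof.
have hlo : (Num.sqrt (2 * pi))^-1 * (1 + t^-1 ^+ 2)^-1 @[t --> +oo]
    --> ((Num.sqrt (2 * pi))^-1 * (1 + 0 * 0)^-1 : R).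
  apply: cvgMl_tmp; apply: cvgV; first by rewrite mul0r addr0 oner_neq0.
  by apply: cvgD; [exact: cvg_cst|apply: cvgM; exact: cvgy_inv].
rewrite mul0r addr0 invr1 mulr1 in hlo.
apply: squeeze_cvgr hlo (cvg_cst _); near=> t.
have t0 : 0 < t by near: t; apply: nbhs_pinfty_gt; rewrite num_real.
have /andP[] := normal_tail_bounds t0; rewrite std_normal_pdfE expRN exprVn.
have e0 := expR_gt0 (t ^+ 2 / 2); rewrite ler_pdivlMr//.
have v0 : 0 < 1 + t ^- 2 by rewrite addr_gt0// invr_gt0 exprn_gt0.
rewrite ler_pdivrMr// => lo hi; apply/andP; split.
  move: hi; rewrite !ler_pdivrMr// => hi; rewrite (le_trans hi)//.
  by rewrite le_eqVlt; apply/orP; left; apply/eqP; ring.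
by rewrite -ler_pdivlMr.
Unshelve. all: by end_near. Qed.

End mills.

(** * Rotation of the standard normal law of the plane *)

Section lebesgue_affine.
Context {R : realType}.
Local Notation mu := (@lebesgue_measure R).

(** By uniqueness of Lebesgue measure, it is enough to look at intervals. *)
Lemma lebesgue_measure_affine (k c : R) (A : set R) :
  0 < k -> measurable A ->
  (k%:E * mu ((fun x : R => (k * x + c)%R) @^-1` A))%E = mu A.
Proof.
move=> k0 mA; pose k' : {nonneg R} := NngNum (ltW k0).
pose T : measurableTypeR R -> measurableTypeR R := fun x => k * x + c.
have mT : measurable_fun setT T.
  by apply: measurable_funD => //; apply: measurable_funM.
apply/esym/(@lebesgue_measure_unique _ (mscale k' (pushforward mu T))) => //=.
move=> _ [[a b]] _ <-.
rewrite /mscale /=.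
have -> : pushforward mu T `]a, b]%classic =
    mu `](a - c) / k, (b - c) / k]%classic.
  congr (mu _); apply/seteqP; split=> x /=;
  rewrite !in_itv/= ltr_pdivrMr// ler_pdivlMr//;
  by rewrite ltrBlDr lerBrDr mulrC.
rewrite !lebesgue_measure_itv/= !lte_fin ltr_pM2r ?invr_gt0// ltrD2r.
case: ifPn => ab; last by rewrite mule0.
by rewrite -!EFinB -EFinM; congr (_%:E); field; rewrite gt_eqF.
Qed.

Lemma ge0_integral_affine (k c : R) (f : R -> \bar R) : 0 < k ->
  measurable_fun setT f -> (forall x, 0 <= f x)%E ->
  (\int[mu]_x f x = k%:E * \int[mu]_x f (k * x + c)%R)%E.
Proof.
move=> k0 mf f0; pose k' : {nonneg R} := NngNum (ltW k0).
pose T : measurableTypeR R -> measurableTypeR R := fun x => k * x + c.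
have mT : measurable_fun setT T.
  by apply: measurable_funD => //; apply: measurable_funM.
have := @ge0_integral_pushforward _ _ _ _ _ _ mT mu setT f measurableT mf.
rewrite preimage_setT => <-//.
rewrite -(ge0_integral_mscale _ _ k')//.
apply: eq_measure_integral => A mA _; apply/esym.
exact: (@lebesgue_measure_affine k c A).
Qed.

End lebesgue_affine.

Section density.
Local Open Scope ereal_scope.
Context d (T : measurableType d) (R : realType).
Context (m : {measure set T -> \bar R}) (f : T -> \bar R).
Context (mf : measurable_fun setT f) (f0 : forall x, 0 <= f x).

(** The two proofs are arguments so that the measure structure can be inferred
from the term [density_measure m mf f0] alone. *)
Definition density_measure (mf : measurable_fun setT f)
  (f0 : forall x, 0 <= f x) (E : set T) := \int[m]_(x in E) f x.

Local Notation D := (density_measure mf f0).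

Let density_measure0 : D set0 = 0.
Proof. exact: integral_set0. Qed.

Let density_measure_ge0 E : 0 <= D E.
Proof. exact: integral_ge0. Qed.

Let density_measure_sigma_additive : semi_sigma_additive D.
Proof.
move=> F mF tF mUF; rewrite /density_measure ge0_integral_bigcup//; last first.
  exact: measurable_funTS.
by apply: is_cvg_ereal_nneg_natsum_cond => n _ _; exact: integral_ge0.
Qed.

HB.instance Definition _ := isMeasure.Build _ _ _ D
  density_measure0 density_measure_ge0 density_measure_sigma_additive.

End density.

Section rotation.
Context {R : realType}.
Local Notation mu := (@lebesgue_measure R).
Local Notation sqrt2 := (Num.sqrt 2 : R).
Local Notation mR := (measurableTypeR R).

Definition rot45 (z : mR * mR) : mR * mR :=
  ((z.1 + z.2) / sqrt2, (z.2 - z.1) / sqrt2).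

Lemma measurable_rot45 : measurable_fun setT rot45.
Proof.
by apply: measurable_fun_pair; apply: measurable_funM => //;
  [apply: measurable_funD|apply: measurable_funB].
Qed.

(** Lebesgue measure of the plane is invariant under the rotation. By Tonelli,
substitute x = sqrt 2 u - y at fixed y, then y = (u + v) / sqrt 2 at fixed u:
the scale factors sqrt 2 and 1 / sqrt 2 cancel. *)
Lemma ge0_integral_rot45 (g : mR * mR -> \bar R) :
  measurable_fun setT g -> (forall z, 0 <= g z)%E ->
  (\int[mu \x mu]_z g (rot45 z) = \int[mu \x mu]_z g z)%E.
Proof.
move=> mg g0; have s0 : 0 < sqrt2 by rewrite sqrtr_gt0.
have s2 : sqrt2 * sqrt2 = 2 by rewrite -expr2 sqr_sqrtr.
have mrot := measurableT_comp mg measurable_rot45.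
(* The integrand after the first substitution, in the variables (u, y). *)
pose h (z : mR * mR) := g (z.1, sqrt2 * z.2 - z.1).
have h0 z : (0 <= h z)%E by exact: g0.
have mh : measurable_fun setT h.
  apply: measurableT_comp => //; apply: measurable_fun_pair => //.
  by apply: measurable_funB => //; apply: measurable_funM.
rewrite (fubini_tonelli2 (g \o rot45))//= /fubini_G.
transitivity (\int[mu]_y (sqrt2%:E * \int[mu]_u h (u, y)))%E.
  apply: eq_integral => y _.
  rewrite [LHS](@ge0_integral_affine R sqrt2 (- y))//=; last first.
    exact: (measurable_fun_pair1 y mrot).
  congr (_ * _)%E; apply: eq_integral => u _; rewrite /h /rot45 /=.
  have sn0 : sqrt2 != 0 by rewrite gt_eqF.
  congr (g (_, _)); apply: (mulIf sn0); rewrite divfK//; first by ring.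
  by rewrite mulrBl mulrAC s2; ring.
rewrite ge0_integralZl//; last 2 first.
- exact: (measurable_fun_fubini_tonelli_G h mh h0).
- by move=> y _; apply: integral_ge0.
rewrite -(fubini_tonelli h)// fubini_tonelli1//.
rewrite -ge0_integralZl//; last 2 first.
- exact: (measurable_fun_fubini_tonelli_F h mh h0).
- by move=> y _; apply: integral_ge0.
apply: eq_integral => u _; rewrite /fubini_F /h /=.
rewrite [RHS](@ge0_integral_affine R sqrt2 (- u))//.
exact: (measurable_fun_pair2 u mg).
Qed.

Definition std_normal2 : probability (mR * mR)%type R :=
  (normal_prob (0 : R) 1 \x normal_prob (0 : R) 1)%E.

Let pdf2 (z : mR * mR) : \bar R := (normal_pdf 0 1 z.1 * normal_pdf 0 1 z.2)%:E.

Let mpdf2 : measurable_fun setT pdf2.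
Proof.
apply/measurable_EFinP; apply: measurable_funM; apply: measurableT_comp => //;
exact: measurable_normal_pdf.
Qed.

Let pdf2_ge0 z : (0 <= pdf2 z)%E.
Proof. by rewrite lee_fin mulr_ge0 ?normal_pdf_ge0. Qed.

Let pdf2_rot45 z : pdf2 (rot45 z) = pdf2 z.
Proof.
rewrite /pdf2 !std_normal_pdfE; congr (_%:E).
rewrite mulrACA [RHS]mulrACA -!expRD; congr (_ * expR _).
by rewrite /= !expr_div_n sqr_sqrtr//; field.
Qed.

Lemma std_normal2_density E : measurable E ->
  std_normal2 E = (\int[mu \x mu]_(z in E) pdf2 z)%E.
Proof.
move=> mE.
rewrite -[RHS]/(density_measure (mu \x mu)%E mpdf2 pdf2_ge0 E).
apply: product_measure_unique => // A B mA mB.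
rewrite /= /density_measure integral_mkcond.
rewrite fubini_tonelli1//; last 2 first.
- by apply/(measurable_restrictT _ _).1 => //;
    [exact: measurableX|exact: measurable_funTS].
- by move=> z; rewrite patchE; case: ifP.
pose p (x : mR) : \bar R := (normal_pdf 0 1 x)%:E.
have mp : measurable_fun setT p.
  by apply/measurable_EFinP; exact: measurable_normal_pdf.
have p0 x : (0 <= p x)%E by rewrite lee_fin normal_pdf_ge0.
have mpC C : measurable C -> measurable_fun setT (p \_ C).
  move=> mC; apply/(measurable_restrictT _ _).1 => //.
  exact: measurable_funTS.
have pC0 C x : (0 <= (p \_ C) x)%E by rewrite patchE; case: ifP.
transitivity (\int[mu]_x ((p \_ A) x * normal_prob 0%R 1%R B))%E.
  apply: eq_integral => x _; rewrite /fubini_F /normal_prob.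
  rewrite [X in (_ = _ * X)%E]integral_mkcond.
  rewrite -ge0_integralZl//; last exact: mpC.
  apply: eq_integral => y _; rewrite !patchE in_setX.
  (* Outside its domain a restricted function takes the value [point]. *)
  rewrite -[point]/(0 : \bar R)%E.
  by case: (x \in A); case: (y \in B); rewrite /= ?mule0 ?mul0e.
rewrite ge0_integralZr//; last exact: mpC.
by rewrite -integral_mkcond.
Qed.

(** Lebesgue measure and the density, a function of x ^ 2 + y ^ 2, are both
invariant. *)
Lemma std_normal2_rot45 E : measurable E ->
  std_normal2 (rot45 @^-1` E) = std_normal2 E.
Proof.
move=> mE; have mrE : measurable (rot45 @^-1` E).
  by rewrite -[X in measurable X]setTI; exact: measurable_rot45.
rewrite !std_normal2_density// integral_mkcond [RHS]integral_mkcond.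
rewrite -[RHS]ge0_integral_rot45; last 2 first.
- by apply/(measurable_restrictT _ _).1 => //; exact: measurable_funTS.
- by move=> z; rewrite patchE; case: ifP.
by apply: eq_integral => z _; rewrite !patchE pdf2_rot45.
Qed.

End rotation.

(** * Distribution functions of functions of a normal pair *)

Section plane_geometry.
Context {R : realFieldType}.
Implicit Types s x y : R.

(** |x| + |y| is the maximum of |x + y| and |y - x|. *)
Lemma add_norm_le s x y :
  (`|x| + `|y| <= s) = (`|x + y| <= s) && (`|y - x| <= s).
Proof.
apply/idP/andP => [|[]]; case: (ger0P x); case: (ger0P y);
  case: (ger0P (x + y)); case: (ger0P (y - x)); try split; lra.
Qed.

(** ||x| - |y|| is the minimum of |x + y| and |y - x|. *)
Lemma norm_sub_norm_gt s x y :
  (s < `| `|x| - `|y| |) = (s < `|x + y|) && (s < `|y - x|).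
Proof.
apply/idP/andP => [|[]]; case: (ger0P (`|x| - `|y|));
  case: (ger0P x); case: (ger0P y);
  case: (ger0P (x + y)); case: (ger0P (y - x)); try split; lra.
Qed.

(** |x| - |y| > s selects, among the four quadrants where |x + y| > s and
|y - x| > s, the two on which |x| > |y|. *)
Lemma sub_norm_gt s x y : 0 <= s -> s < `|x| - `|y| <->
  (s < x + y /\ y - x < - s) \/ (x + y < - s /\ s < y - x).
Proof.
move=> s0; split => [|[[]|[]]].
  case: (ger0P x) => x0 H; [left|right];
    move: H; case: (ger0P y); split; lra.
all: case: (ger0P x); case: (ger0P y); lra.
Qed.

End plane_geometry.

Lemma measurable_sublevel d (T : measurableType d) (R : realType)
    (f : T -> R) (t : R) :
  measurable_fun setT f -> measurable [set z | f z <= t].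
Proof.
move=> mf; rewrite [X in measurable X](_ : _ = setT `&` f @^-1` `]-oo, t]).
  exact: mf.
by rewrite setTI; apply/seteqP; split => z /=; rewrite in_itv.
Qed.

Section tails.
Context {R : realType}.
Implicit Types s t x y : R.
Local Notation mR := (measurableTypeR R).
Local Notation N := (normal_prob (0 : R) 1).
Local Notation Q := (@normal_tail R).
Local Notation mu := (@std_normal2 R).

Lemma normal_prob_oy t : N `]t, +oo[%classic = (Q t)%:E.
Proof. by rewrite fineK//; exact: fin_num_measure. Qed.

Lemma normal_prob_yo t : N `]-oo, (- t)[%classic = (Q t)%:E.
Proof.
rewrite -normal_prob_oy /normal_prob.
have -> : `]-oo, (- t)[%classic =
    (-%R : mR -> mR) @^-1` `]t, +oo[%classic.
  by apply/seteqP; split => x /=; rewrite !in_itv/= andbT ltrNr.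
transitivity (\int[lebesgue_measure]_(x in (-%R : mR -> mR) @^-1` `]t, +oo[)
   ((fun x => (normal_pdf 0 1 x)%:E) \o (-%R : mR -> mR)) x)%E.
  by apply: eq_integral => x _ /=; rewrite !std_normal_pdfE sqrrN.
rewrite -ge0_integral_pushforward//=.
- by apply: eq_measure_integral => //= A mA _; exact: lebesgue_measureN.
- by apply/measurable_EFinP/measurable_funTS; exact: measurable_normal_pdf.
- by move=> x _; rewrite lee_fin normal_pdf_ge0.
Qed.

Lemma normal_prob_yc t : N `]-oo, t]%classic = (1 - Q t)%:E.
Proof.
have -> : `]-oo, t]%classic = ~` `]t, +oo[%classic :> set R.
  by rewrite setCitvr.
by rewrite probability_setC// EFinB -normal_prob_oy.
Qed.

Lemma normal_prob_norm_gt t : 0 <= t -> N [set x | t < `|x|] = (2 * Q t)%:E.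
Proof.
move=> t0; have -> : [set x : R | t < `|x|] = `]-oo, (- t)[ `|` `]t, +oo[.
  apply/seteqP; split => x /=; rewrite !in_itv/= andbT ltr_normr ltrNr;
  by [move/orP => []; [right|left]|case=> ->; rewrite ?orbT].
rewrite measureU//; last first.
  apply/seteqP; split => // x [] /=; rewrite !in_itv/= andbT; lra.
by rewrite mulr_natl EFinD -[X in (_ + X)%E]normal_prob_oy -normal_prob_yo.
Qed.

Lemma normal_prob_norm_le t :
  0 <= t -> N [set x | `|x| <= t] = (1 - 2 * Q t)%:E.
Proof.
move=> t0; have -> : [set x : R | `|x| <= t] = ~` [set x | t < `|x|].
  by apply/seteqP; split => x /=; rewrite leNgt; move/negP.
rewrite probability_setC//; first by rewrite EFinB -normal_prob_norm_gt.
rewrite [X in measurable X](_ : _ =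
    (Num.norm : R -> R) @^-1` `]t, +oo[); last first.
  by apply/seteqP; split => x /=; rewrite in_itv/= andbT.
by rewrite -[X in measurable X]setTI; apply: normr_measurable.
Qed.

Let s2_gt0 : 0 < Num.sqrt 2 :> R. Proof. by rewrite sqrtr_gt0. Qed.

(** The form in which rotation invariance is used: an event that is a product in
the rotated coordinates has the product probability. *)
Lemma prob_rot45 (A B : set R) (E : set (mR * mR)) :
  measurable A -> measurable B ->
  (forall x y, E (x, y) <->
    A ((x + y) / Num.sqrt 2) /\ B ((y - x) / Num.sqrt 2)) ->
  mu E = (N A * N B)%E.
Proof.
move=> mA mB EAB.
have -> : E = @rot45 R @^-1` (A `*` B).
  by apply/seteqP; split => -[x y] /= /EAB.
rewrite std_normal2_rot45; last exact: measurableX.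
exact: product_measure1E.
Qed.

Let measurable_norm_gt t : measurable [set x : mR | t < `|x|].
Proof.
rewrite [X in measurable X](_ : _ = (Num.norm : R -> R) @^-1` `]t, +oo[).
  by rewrite -[X in measurable X]setTI; apply: normr_measurable.
by apply/seteqP; split => x /=; rewrite in_itv/= andbT.
Qed.

Let measurable_norm_le t : measurable [set x : mR | `|x| <= t].
Proof.
rewrite [X in measurable X](_ : _ = (Num.norm : R -> R) @^-1` `]-oo, t]).
  by rewrite -[X in measurable X]setTI; apply: normr_measurable.
by apply/seteqP; split => x /=; rewrite in_itv/=.
Qed.

Lemma prob_fst (A : set R) : measurable A -> mu (fst @^-1` A) = N A.
Proof.
move=> mA; rewrite (_ : _ @^-1` _ = A `*` setT).
  rewrite [LHS]product_measure1E// [X in (_ * X)%E](_ : _ = 1%E) ?mule1//.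
  exact: probability_setT.
by apply/seteqP; split => -[x y] //= [].
Qed.

Lemma cdf_fst t : mu [set z | z.1 <= t] = (1 - Q t)%:E.
Proof.
by rewrite -normal_prob_yc -prob_fst.
Qed.

Lemma cdf_norm_fst t : 0 <= t -> mu [set z | `|z.1| <= t] = (1 - 2 * Q t)%:E.
Proof.
move=> t0; rewrite -normal_prob_norm_le// -prob_fst//.
exact: measurable_norm_le.
Qed.

Lemma cdf_add t : mu [set z | z.1 + z.2 <= Num.sqrt 2 * t] = (1 - Q t)%:E.
Proof.
rewrite (@prob_rot45 `]-oo, t]%classic setT)//; last first.
  by move=> x y /=; rewrite in_itv/= ler_pdivrMr// mulrC; split=> [|[]].
rewrite [X in (_ * X)%E](_ : _ = 1%E) ?mule1; last exact: probability_setT.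
exact: normal_prob_yc.
Qed.

Lemma normal_prob_cy t : N `[(- t), +oo[%classic = (1 - Q t)%:E.
Proof.
have -> : `[(- t), +oo[%classic = ~` `]-oo, (- t)[%classic :> set R.
  by rewrite setCitvl.
by rewrite probability_setC// EFinB -normal_prob_yo.
Qed.

Lemma cdf_sub t : mu [set z | z.1 - z.2 <= Num.sqrt 2 * t] = (1 - Q t)%:E.
Proof.
rewrite (@prob_rot45 setT `[(- t), +oo[%classic)//; last first.
  move=> x y /=; rewrite in_itv/= andbT lerNl -mulNr ler_pdivrMr// opprB mulrC.
  by split=> [|[]].
rewrite [X in (X * _)%E](_ : _ = 1%E) ?mul1e; last exact: probability_setT.
exact: normal_prob_cy.
Qed.

Let le_norm_div t x : (`|x / Num.sqrt 2| <= t) = (`|x| <= Num.sqrt 2 * t).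
Proof. by rewrite normrM normfV (gtr0_norm s2_gt0) ler_pdivrMr// mulrC. Qed.

Let gt_norm_div t x : (t < `|x / Num.sqrt 2|) = (Num.sqrt 2 * t < `|x|).
Proof. by rewrite normrM normfV (gtr0_norm s2_gt0) ltr_pdivlMr// mulrC. Qed.

Lemma cdf_add_norm t : 0 <= t ->
  mu [set z | `|z.1| + `|z.2| <= Num.sqrt 2 * t] =
  (1 - (4 * Q t - 4 * Q t ^+ 2))%:E.
Proof.
move=> t0; have mle := @measurable_norm_le t.
rewrite (@prob_rot45 [set x | `|x| <= t] [set x | `|x| <= t])//.
  by rewrite !normal_prob_norm_le// -EFinM; congr (_%:E); ring.
by move=> x y /=; rewrite !le_norm_div add_norm_le; split=> /andP.
Qed.

Lemma cdf_norm_sub_norm t : 0 <= t ->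
  mu [set z | `| `|z.1| - `|z.2| | <= Num.sqrt 2 * t] = (1 - 4 * Q t ^+ 2)%:E.
Proof.
move=> t0.
have mE : measurable [set z : mR * mR | `| `|z.1| - `|z.2| | <= Num.sqrt 2 * t].
  apply: measurable_sublevel; apply: measurableT_comp => //.
  by apply: measurable_funB; apply: measurableT_comp.
rewrite -[X in mu X]setCK probability_setC; last exact: measurableC.
have mgt := @measurable_norm_gt t.
rewrite (@prob_rot45 [set x | t < `|x|] [set x | t < `|x|])//.
  by rewrite !normal_prob_norm_gt// -EFinM -EFinB; congr (_%:E); ring.
move=> x y /=; rewrite !gt_norm_div; split=> [/negP|H].
  by rewrite -ltNge norm_sub_norm_gt => /andP.
by apply/negP; rewrite -ltNge norm_sub_norm_gt; apply/andP.
Qed.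

Lemma cdf_sub_norm t : 0 <= t ->
  mu [set z | `|z.1| - `|z.2| <= Num.sqrt 2 * t] = (1 - 2 * Q t ^+ 2)%:E.
Proof.
move=> t0; pose s := Num.sqrt 2 * t.
have s0 : 0 <= s by rewrite mulr_ge0// ltW.
have mE : measurable [set z : mR * mR | `|z.1| - `|z.2| <= s].
  apply: measurable_sublevel.
  by apply: measurable_funB; apply: measurableT_comp.
rewrite -[X in mu X]setCK probability_setC; last exact: measurableC.
pose up := `]t, +oo[%classic : set mR.
pose dn := `]-oo, (- t)[%classic : set mR.
(* The complement is a union of two opposite quadrants in the coordinates of
   [rot45]. *)
rewrite [X in mu X](_ : _ = @rot45 R @^-1` ((up `*` dn) `|` (dn `*` up))).
  have mX (A B : set mR) : measurable A -> measurable B -> measurable (A `*` B).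
    exact: measurableX.
  have mup : measurable up by exact: measurable_itv.
  have mdn : measurable dn by exact: measurable_itv.
  rewrite std_normal2_rot45; last by apply: measurableU; exact: mX.
  rewrite measureU; [|exact: mX|exact: mX|]; last first.
    apply/seteqP; split=> // -[u v] [[/= + _] [/= + _]].
    by rewrite /up /dn/= !in_itv/= andbT; lra.
  have hud : mu (up `*` dn) = (Q t * Q t)%:E.
    rewrite [LHS]product_measure1E// EFinM; congr (_ * _)%E.
      exact: normal_prob_oy.
    exact: normal_prob_yo.
  have hdu : mu (dn `*` up) = (Q t * Q t)%:E.
    rewrite [LHS]product_measure1E// EFinM; congr (_ * _)%E.
      exact: normal_prob_yo.
    exact: normal_prob_oy.
  rewrite [X in (_ - (X + _))%E]hud [X in (_ - (_ + X))%E]hdu.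
  rewrite -(EFinD (Q t * Q t)) -EFinB.
  by congr (_%:E); ring.
have lt_div a : (t < a / Num.sqrt 2) = (s < a).
  by rewrite ltr_pdivlMr// mulrC.
have gt_div a : (a / Num.sqrt 2 < - t) = (a < - s).
  by rewrite ltr_pdivrMr// mulNr mulrC.
apply/seteqP; split=> -[x y];
  rewrite /up /dn /= !in_itv/= !andbT !lt_div !gt_div.
  by move=> /negP; rewrite -ltNge => /(sub_norm_gt _ _ s0).
by move=> /(sub_norm_gt _ _ s0) H; apply/negP; rewrite -ltNge.
Qed.

End tails.

(** * Independence of the pairs *)

Section independent_pairs.
Local Open Scope ereal_scope.
Context {R : realType} d (T : measurableType d) (P : probability T R).
Context d1 d2 (U1 : measurableType d1) (U2 : measurableType d2).
Context (m1 : probability U1 R) (m2 : probability U2 R).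
Context (n : nat) (V : 'I_n -> T -> U1 * U2).
Context (mV : forall i, measurable_fun setT (V i)).

Let measurable_forall (B : 'I_n -> set (U1 * U2)) (p : pred 'I_n) :
  (forall i, measurable (B i)) ->
  measurable [set w | forall i, p i -> B i (V i w)].
Proof.
move=> mB; rewrite [X in measurable X](_ : _ =
    \bigcap_(i in [set i | p i]) (V i @^-1` B i)); last first.
  by apply/seteqP; split => w h i; exact: h.
apply: fin_bigcap_measurable => [|i _]; first exact: finite_finset.
by rewrite -[X in measurable X]setTI; exact: mV.
Qed.

Lemma measure_unique_rectangles (nu1 nu2 : {measure set (U1 * U2) -> \bar R}) :
  nu1 setT < +oo ->
  (forall A A', measurable A -> measurable A' ->
    nu1 (A `*` A') = nu2 (A `*` A')) ->
  forall E, measurable E -> nu1 E = nu2 E.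
Proof.
move=> nu1oo nu12 E mE.
pose G := [set A `*` B | A in @measurable _ U1 & B in @measurable _ U2].
apply: (measure_unique G (fun=> setT)) => //.
- exact: measurable_prod_measurableType.
- move=> _ _ [A mA [B mB <-]] [A' mA' [B' mB' <-]]; rewrite -setXI.
  exists (A `&` A'); first exact: measurableI.
  by exists (B `&` B') => //; exact: measurableI.
- by move=> _; exists setT => //; exists setT => //; rewrite setXTT.
- by rewrite bigcup_const.
- by move=> _ [A mA [B mB <-]]; exact: nu12.
Qed.

(** The product formula holds for products of sets and is extended to arbitrary
measurable sets one index at a time: with the other sets fixed, both sides
of the formula are finite measures in the j-th set, and they agree on
rectangles. *)
Lemma prob_forall_pairs :
  (forall (A : 'I_n -> set U1) (A' : 'I_n -> set U2),
    (forall i, measurable (A i)) -> (forall i, measurable (A' i)) ->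
    P [set w | forall i, (A i `*` A' i) (V i w)] =
    \prod_i (m1 (A i) * m2 (A' i))) ->
  forall B : 'I_n -> set (U1 * U2), (forall i, measurable (B i)) ->
    P [set w | forall i, B i (V i w)] = \prod_i (m1 \x m2) (B i).
Proof.
move=> rect.
(* Induction on the number [k] of indices whose set is arbitrary. *)
have main k (B : 'I_n -> set (U1 * U2)) : (forall i, measurable (B i)) ->
    (forall i : 'I_n, (k <= i)%N -> exists A A',
       [/\ measurable A, measurable A' & B i = A `*` A']) ->
    P [set w | forall i, B i (V i w)] = \prod_i (m1 \x m2) (B i).
  elim: k B => [|k IH] B mB Brect.
    have /choice[A /choice[A' AA']] : forall i, exists A A',
        [/\ measurable A, measurable A' & B i = A `*` A'].
      by move=> i; exact: Brect.
    rewrite (_ : B = fun i => A i `*` A' i); last first.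
      by apply/funext => i; have [] := AA' i.
    rewrite rect; try by move=> i; have [] := AA' i.
    apply: eq_bigr => i _; have [? ? _] := AA' i.
    by rewrite product_measure1E.
  have [kn|nk] := ltnP k n; last first.
    apply: IH => // i ki.
    by have := ltn_ord i; rewrite ltnNge (leq_trans nk ki).
  pose j := Ordinal kn.
  pose E := [set w | forall i, i != j -> B i (V i w)].
  have mE : measurable E by exact: measurable_forall.
  pose BC C i := if i == j then C else B i.
  have BCE C : [set w | forall i, BC C i (V i w)] = V j @^-1` C `&` E.
    apply/seteqP; split => [w h|w [Cw Ew] i].
      split; first by have := h j; rewrite /BC eqxx.
      by move=> i /negbTE ij; have := h i; rewrite /BC ij.
    by rewrite /BC; case: eqVneq => [->//|]; exact: Ew.
  have prodBC C : \prod_i (m1 \x m2) (BC C i) =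
      (m1 \x m2) C * \prod_(i | i != j) (m1 \x m2) (B i).
    rewrite (bigD1 j)//= {1}/BC eqxx; congr (_ * _).
    by apply: eq_bigr => i /negbTE ij; rewrite /BC ij.
  have step A A' : measurable A -> measurable A' ->
      P (V j @^-1` (A `*` A') `&` E) =
      (m1 \x m2) (A `*` A') * \prod_(i | i != j) (m1 \x m2) (B i).
    move=> mA mA'; rewrite -BCE -prodBC; apply: IH => i.
      by rewrite /BC; case: ifP => // _; exact: measurableX.
    rewrite /BC; case: eqVneq => [_ _|ij ki]; first by exists A, A'.
    by apply: Brect; rewrite ltn_neqAle ki eq_sym andbT.
  (* The constant of proportionality is read off at the full rectangle. *)
  have PE : P E = \prod_(i | i != j) (m1 \x m2) (B i).
    have := step setT setT measurableT measurableT.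
    rewrite setXTT preimage_setT setTI => ->.
    by rewrite [X in X * _](_ : _ = 1) ?mul1e//; exact: probability_setT.
  have PE0 : (0 <= fine (P E))%R by exact: fine_ge0.
  have PEfin : (fine (P E))%:E = P E by rewrite fineK// fin_num_measure.
  have ext C : measurable C ->
      pushforward (mrestr P mE) (V j) C = mscale (NngNum PE0) (m1 \x m2) C.
    apply: measure_unique_rectangles => [|A A' mA mA'].
      by rewrite /pushforward /mrestr/=;
        rewrite (le_lt_trans (probability_le1 _ _)) ?ltry//;
        rewrite preimage_setT setTI.
    transitivity ((fine (P E))%:E * (m1 \x m2) (A `*` A')) => //.
    by rewrite PEfin [LHS]step// PE muleC.
  have -> : [set w | forall i, B i (V i w)] = V j @^-1` B j `&` E.
    rewrite -BCE; apply/seteqP; split => w h i; have := h i; rewrite /BC;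
    by case: eqVneq => // ->.
  rewrite [LHS](ext (B j))// -[LHS]/((fine (P E))%:E * (m1 \x m2) (B j)).
  rewrite PEfin PE muleC.
  by rewrite [RHS](bigD1 j).
by move=> B mB; apply: (main n) => // i; rewrite leqNgt ltn_ord.
Qed.

End independent_pairs.

(** * Asymptotics of the tails *)

Section tail_asymptotics.
Context {R : realType}.
Implicit Types t : R.
Local Notation Q := (@normal_tail R).
Local Notation C0 := ((Num.sqrt (2 * pi))^-1 : R).

Lemma normal_tail_ge0 t : 0 <= Q t.
Proof. exact: fine_ge0. Qed.

Lemma cvg_normal_tail0 : Q t @[t --> +oo] --> 0.
Proof.
have h : Q t * t * expR (t ^+ 2 / 2) * t^-1 @[t --> +oo] --> C0 * 0.
  by apply: cvgM; [exact: cvg_normal_tail|exact: cvgy_inv].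
rewrite mulr0 in h; apply: squeeze_cvgr (cvg_cst 0) h; near=> t.
have t0 : 0 < t by near: t; apply: nbhs_pinfty_gt; rewrite num_real.
rewrite normal_tail_ge0/= mulrAC mulfK ?gt_eqF// ler_peMr ?normal_tail_ge0//.
by rewrite -expR0 ler_expR divr_ge0 ?sqr_ge0.
Unshelve. all: by end_near. Qed.

Lemma cvg_scale_normal_tail (k : R) :
  (k * Q t) * t ^+ 1 * expR (t ^+ 2 / 2) @[t --> +oo] --> k * C0.
Proof.
have h : k * (Q t * t * expR (t ^+ 2 / 2)) @[t --> +oo] --> k * C0.
  by apply: cvgMl_tmp; exact: cvg_normal_tail.
by apply: cvg_trans h; apply: near_eq_cvg; near=> t; rewrite expr1 !mulrA.
Unshelve. all: by end_near. Qed.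

(** The tail of |x| + |y|: the square of Q is negligible against Q. *)
Lemma cvg_add_norm_tail :
  (4 * Q t - 4 * Q t ^+ 2) * t ^+ 1 * expR (t ^+ 2 / 2) @[t --> +oo] --> 4 * C0.
Proof.
have h : 4 * Q t * t ^+ 1 * expR (t ^+ 2 / 2) * (1 - Q t) @[t --> +oo]
    --> 4 * C0 * (1 - 0).
  apply: cvgM; first exact: cvg_scale_normal_tail.
  by apply: cvgB; [exact: cvg_cst|exact: cvg_normal_tail0].
rewrite subr0 mulr1 in h; apply: cvg_trans h; apply: near_eq_cvg; near=> t.
ring.
Unshelve. all: by end_near. Qed.

(** The square of Q (t / sqrt 2) decays like exp (- t ^ 2 / 2): squaring
compensates for the scaling. *)
Lemma cvg_normal_tail_sqr (k : R) :
  (k * Q (t / Num.sqrt 2) ^+ 2) * t ^+ 2 * expR (t ^+ 2 / 2) @[t --> +oo]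
    --> k / pi.
Proof.
have s0 : 0 < Num.sqrt 2 :> R by rewrite sqrtr_gt0.
have too : t * (Num.sqrt 2)^-1 @[t --> +oo] --> (+oo : set_system R).
  by apply: gt0_cvgMly; rewrite ?invr_gt0.
pose G t := Q t * t * expR (t ^+ 2 / 2).
have hG : G (t / Num.sqrt 2) @[t --> +oo] --> C0.
  exact: (cvg_comp _ _ too cvg_normal_tail).
have h : 2 * k * (G (t / Num.sqrt 2) * G (t / Num.sqrt 2)) @[t --> +oo]
   --> 2 * k * (C0 * C0).
  by apply: cvgMl_tmp; exact: cvgM.
have pi0 : 0 < pi :> R := pi_gt0 R.
have e : 2 * k * (C0 * C0) = k / pi.
  rewrite -invfM -expr2 sqr_sqrtr ?mulr_ge0 ?(ltW pi0)//.
  by move: (pi : R) pi0 => q q0; field; rewrite gt_eqF.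
rewrite e in h; apply: cvg_trans h; apply: near_eq_cvg; near=> t.
have tE : t ^+ 2 / 2 = (t / Num.sqrt 2) ^+ 2 by rewrite expr_div_n sqr_sqrtr.
have t2 : t ^+ 2 = 2 * (t / Num.sqrt 2) ^+ 2 by rewrite -tE; field.
rewrite /G t2; move: (t / _) => y.
have -> : 2 * y ^+ 2 / 2 = y ^+ 2 / 2 + y ^+ 2 / 2 by field.
by rewrite expRD; ring.
Unshelve. all: by end_near. Qed.

End tail_asymptotics.

(** * Maxima of functions of normal pairs *)

Section maxima.
Context {R : realType}.
Local Notation mR := (measurableTypeR R).
Local Notation mu := (@std_normal2 R).

(** The maximum is at most t when every pair lies in the sublevel set of f. *)
Lemma prob_max_pairs_le d (T : measurableType d) (P : probability T R) (n : nat)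
    (X Y : 'I_n -> {RV P >-> R}) (f : mR * mR -> R) (t p : R) :
  (0 < n)%N -> iid_standard_normal (joint X Y) -> measurable_fun setT f ->
  mu [set z | f z <= t] = p%:E ->
  P [set w | maxI (fun i => f (X i w, Y i w)) <= t] = (p ^+ n)%:E.
Proof.
move=> n0 [indep gauss] mf mup.
pose V i w := (X i w, Y i w) : mR * mR.
have mV i : measurable_fun setT (V i).
  by apply: measurable_fun_pair;
    [exact: (measurable_funPT (X i))|exact: (measurable_funPT (Y i))].
pose B (i : 'I_n) := [set z | f z <= t].
have mB i : measurable (B i) by exact: measurable_sublevel.
have -> : [set w | maxI (fun i => f (X i w, Y i w)) <= t] =
    [set w | forall i, B i (V i w)].
  by apply/seteqP; split => w /=; rewrite maxI_le// => /forallP.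
have rect (A A' : 'I_n -> set R) :
    (forall i, measurable (A i)) -> (forall i, measurable (A' i)) ->
    P [set w | forall i, (A i `*` A' i) (V i w)] =
    (\prod_i (normal_prob 0 1 (A i) * normal_prob 0 1 (A' i)))%E.
  move=> mA mA'.
  pose AA (k : 'I_n + 'I_n) := match k with inl i => A i | inr i => A' i end.
  have mAA k : measurable (AA k) by case: k.
  have := indep [set: 'I_n + 'I_n]%SET AA mAA.
  rewrite (eq_bigr (fun k => normal_prob 0 1 (AA k))); last first.
    by move=> k _; exact: gauss.
  rewrite (eq_bigl predT) => [|k]; last by rewrite inE.
  rewrite big_sumType /= -big_split /= => <-.
  congr (P _); apply/seteqP; split => [w h [i|i] _|w h i];
    try by have [] := h i.
  by split; [apply: (h (inl i))|apply: (h (inr i))]; rewrite /= inE.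
rewrite [LHS](prob_forall_pairs mV rect mB).
rewrite (eq_bigr (fun=> p%:E)) => [|i _]; last exact: mup.
by rewrite prodEFin prodr_const card_ord.
Qed.

(** The scheme common to all cases. The scale [s] is 1 or sqrt 2; the equation
on [a] and [b] says that the level a_n x + b_n is s times the one of
[cvg_tail_norming]. *)
Lemma max_cvg_gumbel_tail (d : nat -> measure_display)
    (T : forall n, measurableType (d n)) (P : forall n, probability (T n) R)
    (X Y : forall n, 'I_n -> {RV (P n) >-> R})
    (f : mR * mR -> R) (H : R -> R) (s c K C : R) (k : nat) (a b : nat -> R) :
  (forall n, (2 <= n)%N -> iid_standard_normal (joint (X n) (Y n))) ->
  measurable_fun setT f ->
  (forall t, 0 <= t -> mu [set z | f z <= s * t] = (1 - H t)%:E) ->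
  H t * t ^+ k * expR (t ^+ 2 / 2) @[t --> +oo] --> C ->
  1 <= c -> 0 < K -> K * C = c ->
  (forall n, (2 <= n)%N -> let u := Num.sqrt (2 * ln (c * n%:R)) in
    0 < a n /\
    forall x, a n * x + b n = s * (u + (x - ln (K * u ^+ k)) / u)) ->
  max_cvg_gumbel P (fun n i w => f (X n i w, Y n i w)) a b.
Proof.
move=> iid mf cdf HC c1 K0 KC ab; split=> [n n2|x]; first by have [] := ab n n2.
pose u n := Num.sqrt (2 * ln (c * n%:R)).
have c0 : 0 < c by exact: lt_le_trans c1.
have scale_oo (r : R) : 0 < r -> r * y @[y --> +oo] --> +oo.
  by move=> r0; apply: (gt0_cvgMry r0); exact: cvg_id.
have cnoo : c * n%:R @[n --> \oo] --> +oo.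
  exact: (cvg_comp _ _ cvgr_idn (scale_oo _ c0)).
have Loo : 2 * ln (c * n%:R) @[n --> \oo] --> +oo.
  exact: (cvg_comp _ _ (cvg_comp _ _ cnoo cvgy_ln) (scale_oo _ (ltr0n _ 2))).
have uoo : u n @[n --> \oo] --> +oo by exact: (cvg_comp _ _ Loo cvgy_sqrt).
have ueq : \forall n \near \oo, expR (u n ^+ 2 / 2) = c * n%:R.
  near=> n; have n1 : 1 <= n%:R :> R.
    by rewrite ler1n; near: n; exact: nbhs_infty_gt.
  have cn1 : 1 <= c * n%:R by rewrite mulr_ege1.
  rewrite sqr_sqrtr ?mulr_ge0 ?ln_ge0// mulrAC divff// mul1r lnK//.
  by rewrite posrE (lt_le_trans _ cn1).
pose t n := u n + (x - ln (K * u n ^+ k)) / u n.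
have tH : n%:R * H (t n) @[n --> \oo] --> expR (- x).
  exact: (cvg_tail_norming K0 c0 KC HC uoo ueq).
have t_ge0 : \forall n \near \oo, 0 <= t n.
  by apply: cvgry_ge; exact: cvg_norming.
have Ht_ge0 : \forall n \near \oo, 0 <= H (t n).
  near=> n; have : (mu [set z | (f z <= s * t n)%R] <= 1)%E
    by apply: probability_le1; exact: measurable_sublevel.
  by rewrite cdf ?lee_fin ?lerBlDr ?lerDl//; near: n.
have lim : ((1 - H (t n)) ^+ n)%:E @[n --> \oo] --> (gumbel_cdf x)%:E.
  by apply: cvg_EFin; [near=> n|exact: (cvg_onem_exprn Ht_ge0 tH)].
apply: cvg_trans lim; apply: near_eq_cvg; near=> n.
have n2 : (2 <= n)%N by near: n; exact: nbhs_infty_ge.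
have [an0 abx] := ab n n2.
have tn0 : 0 <= t n by near: n.
rewrite /= -(@prob_max_pairs_le _ _ _ _ _ _ f (s * t n) (1 - H (t n)) _
  (iid n n2))//; last 2 first.
- exact: leq_trans n2.
- exact: cdf.
congr (P n _); apply/seteqP; split => w /=;
  by rewrite -abx ler_pdivrMl// lerBlDr.
Unshelve. all: by end_near. Qed.

End maxima.

(** * Norming constants *)

Section norming_constants.
Context {R : realType}.
Implicit Types (L a b : R).

Let sqrt_gt0 L : 0 < L -> 0 < Num.sqrt L :> R.
Proof. by rewrite sqrtr_gt0. Qed.

(** K = sqrt (2 pi) is the inverse of the constant in [cvg_normal_tail], and
(K u) ^ 2 = 4 pi L when u = sqrt (2 L). *)
Lemma ln_sqrt2pi_mul L : 0 < L ->
  ln (Num.sqrt (2 * pi) * Num.sqrt (2 * L) ^+ 1) = ln (4 * pi * L) / 2.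
Proof.
move=> L0; have pi0 : 0 < pi :> R := pi_gt0 R.
rewrite expr1 -sqrtrM ?mulr_ge0 ?(ltW pi0)//.
have -> : 4 * pi * L = 2 * pi * (2 * L) by ring.
have D0 : 0 < 2 * pi * (2 * L) by rewrite !mulr_gt0.
rewrite -[in RHS](sqr_sqrtr (ltW D0)) lnXn ?sqrtr_gt0// -mulr_natl.
by field.
Qed.

(** K = pi / 2 is the inverse of the limit in [cvg_normal_tail_sqr] at [k = 2],
and K u ^ 2 = pi L when u = sqrt (2 L). *)
Lemma ln_halfpi_mul L : 0 < L ->
  ln (pi / 2 * Num.sqrt (2 * L) ^+ 2) = ln (pi * L).
Proof.
move=> L0; rewrite sqr_sqrtr ?mulr_ge0 ?(ltW L0)//; congr ln.
by move: (pi : R) => q; field.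
Qed.

(** Tails of order exp (- t ^ 2 / 2) / t, with s = 1. *)
Lemma norming_linear L x : 0 < L ->
  let u := Num.sqrt (2 * L) in
  1 / u * x + (u - ln (4 * pi * L) / (2 * u)) =
  1 * (u + (x - ln (Num.sqrt (2 * pi) * u ^+ 1)) / u).
Proof.
move=> L0 u; rewrite ln_sqrt2pi_mul//; field.
by rewrite gt_eqF// sqrt_gt0// mulr_gt0.
Qed.

(** Tails of order exp (- t ^ 2 / 2) / t, with s = sqrt 2. *)
Lemma norming_diagonal L x : 0 < L ->
  let u := Num.sqrt (2 * L) in
  1 / Num.sqrt L * x + (2 * Num.sqrt L - ln (4 * pi * L) / (2 * Num.sqrt L)) =
  Num.sqrt 2 * (u + (x - ln (Num.sqrt (2 * pi) * u ^+ 1)) / u).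
Proof.
move=> L0 u; rewrite ln_sqrt2pi_mul// /u sqrtrM//.
have s2 : Num.sqrt 2 * Num.sqrt 2 = 2 :> R by rewrite -expr2 sqr_sqrtr.
have s20 := sqrt_gt0 (ltr0n R 2); have sL0 := sqrt_gt0 L0.
transitivity (Num.sqrt 2 * Num.sqrt 2 * Num.sqrt L
    + (x - ln (4 * pi * L) / 2) / Num.sqrt L).
  by rewrite s2; field; rewrite gt_eqF.
by field; rewrite !gt_eqF.
Qed.

(** Tails of order exp (- t ^ 2 / 2) / t ^ 2, with s = 1. *)
Lemma norming_quadratic L x : 0 < L ->
  let u := Num.sqrt (2 * L) in
  1 / u * x + (u - ln (pi * L) / u) =
  1 * (u + (x - ln (pi / 2 * u ^+ 2)) / u).
Proof.
move=> L0 u; rewrite ln_halfpi_mul//; field.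
by rewrite gt_eqF// sqrt_gt0// mulr_gt0.
Qed.

End norming_constants.

Theorem proposition2p1 (R : realType) (d : nat -> measure_display)
    (T : forall n : nat, measurableType (d n))
    (P : forall n : nat, probability (T n) R)
    (X Y : forall n : nat, 'I_n -> {RV (P n) >-> R})
    (XY_iid : forall n : nat, (2 <= n)%N ->
       iid_standard_normal (joint (X n) (Y n))) :
  (let delta := fun n : nat =>
     - (ln (4 * pi * ln n%:R) / (2 * Num.sqrt (2 * ln n%:R))) in
   max_cvg_gumbel P (fun n i w => X n i w)
     (fun n => 1 / Num.sqrt (2 * ln n%:R))
     (fun n => Num.sqrt (2 * ln n%:R) + delta n)) /\
  (let delta := fun n : nat =>
     - (ln (4 * pi * ln (2 * n%:R)) / (2 * Num.sqrt (2 * ln (2 * n%:R)))) in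
   max_cvg_gumbel P (fun n i w => `|X n i w|)
     (fun n => 1 / Num.sqrt (2 * ln (2 * n%:R)))
     (fun n => Num.sqrt (2 * ln (2 * n%:R)) + delta n)) /\
  (let delta := fun n : nat =>
     - (ln (4 * pi * ln n%:R) / (2 * Num.sqrt (ln n%:R))) in
   let a := fun n : nat => 1 / Num.sqrt (ln n%:R) in
   let b := fun n : nat => 2 * Num.sqrt (ln n%:R) + delta n in
   max_cvg_gumbel P (fun n i w => X n i w + Y n i w) a b /\
   max_cvg_gumbel P (fun n i w => X n i w - Y n i w) a b) /\
  (let delta := fun n : nat =>
     - (ln (4 * pi * ln (4 * n%:R)) / (2 * Num.sqrt (ln (4 * n%:R)))) in
   max_cvg_gumbel P (fun n i w => `|X n i w| + `|Y n i w|)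
     (fun n => 1 / Num.sqrt (ln (4 * n%:R)))
     (fun n => 2 * Num.sqrt (ln (4 * n%:R)) + delta n)) /\
  (let delta := fun n : nat =>
     - (ln (pi * ln n%:R) / Num.sqrt (2 * ln n%:R)) in
   max_cvg_gumbel P (fun n i w => `|X n i w| - `|Y n i w|)
     (fun n => 1 / Num.sqrt (2 * ln n%:R))
     (fun n => Num.sqrt (2 * ln n%:R) + delta n)) /\
  (let delta := fun n : nat =>
     - (ln (pi * ln (2 * n%:R)) / Num.sqrt (2 * ln (2 * n%:R))) in
   max_cvg_gumbel P (fun n i w => `| `|X n i w| - `|Y n i w| |)
     (fun n => 1 / Num.sqrt (2 * ln (2 * n%:R)))
     (fun n => Num.sqrt (2 * ln (2 * n%:R)) + delta n)).
Proof.
have ln_pos (c : R) n : 1 <= c -> (2 <= n)%N -> 0 < ln (c * n%:R).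
  move=> c1 n2; rewrite ln_gt0//; have : 2 <= n%:R :> R by rewrite ler_nat.
  nra.
have sn0 L : 0 < L -> 0 < 1 / Num.sqrt L :> R.
  by move=> L0; rewrite mul1r invr_gt0 sqrtr_gt0.
have pi0 : 0 < pi :> R := pi_gt0 R.
have K1 : 0 < Num.sqrt (2 * pi) :> R by rewrite sqrtr_gt0 mulr_gt0.
have K2 : 0 < pi / 2 :> R by rewrite divr_gt0.
(* The relation K C = c for the tails linear in Q and for the quadratic ones. *)
have KC1 (c : R) : Num.sqrt (2 * pi) * (c * (Num.sqrt (2 * pi))^-1) = c.
  by rewrite mulrCA divff ?mulr1// gt_eqF.
have KC2 (c : R) : pi / 2 * (2 * c / pi) = c.
  by move: (pi : R) pi0 => q q0; field; rewrite gt_eqF.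
have mf1 := @measurable_fst _ _ (measurableTypeR R) (measurableTypeR R).
have mf2 := @measurable_snd _ _ (measurableTypeR R) (measurableTypeR R).
have mn (g : measurableTypeR R * measurableTypeR R -> R) :
  measurable_fun setT g -> measurable_fun setT (fun z => `|g z|).
  by move=> mg; exact: measurableT_comp.
have n1 n : n%:R = 1 * n%:R :> R by rewrite mul1r.
have sK (t : R) : Num.sqrt 2 * (t / Num.sqrt 2) = t.
  by rewrite mulrC divfK// gt_eqF// sqrtr_gt0.
split; [|split; [|split; [split|split; [|split]]]].
- move=> delta; apply: (@max_cvg_gumbel_tail R d T P X Y
    fst (fun t => 1 * normal_tail t)
    1 1 (Num.sqrt (2 * pi)) (1 * (Num.sqrt (2 * pi))^-1) 1) => //.
  + by move=> t _; rewrite !mul1r cdf_fst.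
  + exact: cvg_scale_normal_tail.
  + move=> n n2; rewrite -n1; have := ln_pos 1 n (lexx _) n2; rewrite -n1 => L0.
    by split=> [|x]; [rewrite sn0// mulr_gt0|exact: norming_linear].
- move=> delta; apply: (@max_cvg_gumbel_tail R d T P X Y
    (fun z => `|z.1|)
    (fun t => 2 * normal_tail t)
    1 2 (Num.sqrt (2 * pi)) (2 * (Num.sqrt (2 * pi))^-1) 1) => //.
  + exact: mn.
  + by move=> t t0; rewrite mul1r cdf_norm_fst.
  + exact: cvg_scale_normal_tail.
  + by rewrite ler1n.
  + move=> n n2; have L0 : 0 < ln (2 * n%:R) :> R.
      by apply: (ln_pos 2 n _ n2); rewrite ler1n.
    by split=> [|x]; [rewrite sn0// mulr_gt0|exact: norming_linear].
- apply: (@max_cvg_gumbel_tail R d T P X Y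
    (fun z => z.1 + z.2)
    (fun t => 1 * normal_tail t)
    (Num.sqrt 2) 1 (Num.sqrt (2 * pi)) (1 * (Num.sqrt (2 * pi))^-1) 1) => //.
  + exact: measurable_funD.
  + by move=> t t0; rewrite mul1r cdf_add.
  + exact: cvg_scale_normal_tail.
  + move=> n n2; rewrite -n1; have := ln_pos 1 n (lexx _) n2; rewrite -n1 => L0.
    by split=> [|x]; [rewrite sn0|exact: norming_diagonal].
- apply: (@max_cvg_gumbel_tail R d T P X Y
    (fun z => z.1 - z.2)
    (fun t => 1 * normal_tail t)
    (Num.sqrt 2) 1 (Num.sqrt (2 * pi)) (1 * (Num.sqrt (2 * pi))^-1) 1) => //.
  + exact: measurable_funB.
  + by move=> t t0; rewrite mul1r cdf_sub.
  + exact: cvg_scale_normal_tail.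
  + move=> n n2; rewrite -n1; have := ln_pos 1 n (lexx _) n2; rewrite -n1 => L0.
    by split=> [|x]; [rewrite sn0|exact: norming_diagonal].
- move=> delta; apply: (@max_cvg_gumbel_tail R d T P X Y
    (fun z => `|z.1| + `|z.2|)
    (fun t => 4 * normal_tail t - 4 * normal_tail t ^+ 2)
    (Num.sqrt 2) 4 (Num.sqrt (2 * pi)) (4 * (Num.sqrt (2 * pi))^-1) 1) => //.
  + by apply: measurable_funD; exact: mn.
  + exact: cdf_add_norm.
  + exact: cvg_add_norm_tail.
  + by rewrite ler1n.
  + move=> n n2; have L0 : 0 < ln (4 * n%:R) :> R.
      by apply: (ln_pos 4 n _ n2); rewrite ler1n.
    by split=> [|x]; [rewrite sn0|exact: norming_diagonal].
- move=> delta; apply: (@max_cvg_gumbel_tail R d T P X Y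
    (fun z => `|z.1| - `|z.2|)
    (fun t => 2 * normal_tail (t / Num.sqrt 2) ^+ 2)
    1 1 (pi / 2) (2 / pi) 2) => //.
  + by apply: measurable_funB; exact: mn.
  + move=> t t0; have := cdf_sub_norm (divr_ge0 t0 (sqrtr_ge0 2)).
    by rewrite sK mul1r.
  + exact: cvg_normal_tail_sqr.
  + by rewrite -[RHS](KC2 1) mulr1.
  + move=> n n2; rewrite -n1; have := ln_pos 1 n (lexx _) n2; rewrite -n1 => L0.
    by split=> [|x]; [rewrite sn0// mulr_gt0|exact: norming_quadratic].
- move=> delta; apply: (@max_cvg_gumbel_tail R d T P X Y
    (fun z => `| `|z.1| - `|z.2| |)
    (fun t => 4 * normal_tail (t / Num.sqrt 2) ^+ 2)
    1 2 (pi / 2) (4 / pi) 2) => //.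
  + by apply: (mn); apply: measurable_funB; exact: mn.
  + move=> t t0; have := cdf_norm_sub_norm (divr_ge0 t0 (sqrtr_ge0 2)).
    by rewrite sK mul1r.
  + exact: cvg_normal_tail_sqr.
  + by rewrite ler1n.
  + by rewrite -[RHS](KC2 2); congr (_ * (_ / _)); rewrite -natrM.
  + move=> n n2; have L0 : 0 < ln (2 * n%:R) :> R.
      by apply: (ln_pos 2 n _ n2); rewrite ler1n.
    by split=> [|x]; [rewrite sn0// mulr_gt0|exact: norming_quadratic].
Qed.
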